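(* Let $f(x,y)=x^2+y^3$ on $\mathbb{R}^2$. Suppose that $f$ satisfies no nontrivial $1$-variable identities in $\mathbb{R}$. Let $n$ be a positive integer and let $\{x_1,x_2,\ldots,x_n\}$ be a set of variables. Then $f$ satisfies no nontrivial identities involving the variables $x_1,x_2,\ldots,x_n$ in $\mathbb{R}$.
   Context: An expression formed by recursively applying $f$ to a set of variables is a formal (symbolic) expression built as follows: each variable is an expression, and if $G,H$ are expressions then so is $f(G,H)$. Every expression in the variables $x_1,\ldots,x_n$ evaluates to a polynomial in $x_1,\ldots,x_n$ by interpreting $f(G,H)$ as $G^2+H^3$. A nontrivial identity in the variables $x_1,\ldots,x_n$ satisfied by $f$ in $\mathbb{R}$ is a pair of distinct (as symbolic expressions) expressions $G\neq H$ in these variables whose values are equal for all real values of the variables, equivalently, which are equal as polynomials. A $1$-variable identity is the case of a single variable $x$. *)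

(* Defs.v *)
From mathcomp Require Import all_boot all_order all_algebra.
From mathcomp Require Import reals.

Set Implicit Arguments.
Unset Strict Implicit.
Unset Printing Implicit Defensive.

Import GRing.Theory.
Local Open Scope ring_scope.

(* Expressions are purely syntactic, so that Leibniz equality on [expr n] is
   identity of symbolic expressions.  As in "an expression in x_1, ..., x_n",
   an element of [expr n] need not use every variable. *)
Inductive expr (n : nat) : Type :=
| Var of 'I_n
| App of expr n & expr n.

Fixpoint eval (n : nat) (T : Type) (op : T -> T -> T) (v : 'I_n -> T)
    (G : expr n) : T :=
  match G with
  | Var i => v i
  | App G1 G2 => op (eval op v G1) (eval op v G2)
  end.

Definition nontrivial_identity (n : nat) (T : Type) (op : T -> T -> T)
    (G H : expr n) : Prop :=
  G <> H /\ forall v : 'I_n -> T, eval op v G = eval op v H.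

Definition no_nontrivial_identities (n : nat) (T : Type)
    (op : T -> T -> T) : Prop :=
  ~ exists G H : expr n, nontrivial_identity op G H.

Definition f (R : realType) (x y : R) : R := x ^+ 2 + y ^+ 3.

(* Main.v *)
Require Import Defs.
From mathcomp Require Import all_boot all_order all_algebra.
From mathcomp Require Import reals.

(** The free magma on one generator x contains a free magma on countably many
    generators, for instance the one generated by the right combs
    c_i = x(x(...(xx))) with i + 2 leaves.  Indeed each c_i has the bare
    variable x as its left factor, whereas a product of two elements of the
    submagma has a product as its left factor; so no c_i is a product of
    elements of the submagma, and substituting c_i for x_i is injective on
    expressions (lemma [subst_comb_inj]).  As evaluation commutes with
    substitution ([eval_subst]), a nontrivial identity in n variables becomes a
    nontrivial identity in one variable.  Nothing about the operation is used,
    so the argument is given for an arbitrary magma. *)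

(** Simultaneous substitution of the expressions [s i] for the variables. *)
Fixpoint subst {n m : nat} (s : 'I_n -> expr m) (G : expr n) : expr m :=
  match G with
  | Var i => s i
  | App G1 G2 => App (subst s G1) (subst s G2)
  end.

Lemma eval_subst (n m : nat) (T : Type) (op : T -> T -> T) (v : 'I_m -> T)
    (s : 'I_n -> expr m) (G : expr n) :
  eval op v (subst s G) = eval op (fun i => eval op v (s i)) G.
Proof. by elim: G => //= G1 -> G2 ->. Qed.

(** The left multiplication by the variable, iterated [k] times on it: the
    right comb with [k.+1] leaves. *)
Definition right_comb (k : nat) : expr 1 :=
  iter k (App (Var ord0)) (Var ord0).

Lemma right_comb_inj : injective right_comb.
Proof. by elim=> [|k IHk] [|l] //= [/IHk ->]. Qed.

(** The comb with a single leaf is excluded: the argument needs every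
    generator to be a product. *)
Definition comb_gen (n : nat) (i : 'I_n) : expr 1 := right_comb i.+1.

Lemma subst_comb_neq_Var (n : nat) (G : expr n) (j : 'I_1) :
  subst (@comb_gen n) G <> Var j.
Proof. by case: G. Qed.

Lemma subst_comb_inj (n : nat) : injective (subst (@comb_gen n)).
Proof.
elim=> [i|G1 IH1 G2 IH2] [j|H1 H2] /=.
- by move=> /right_comb_inj [/val_inj ->].
- by case=> /esym/subst_comb_neq_Var.
- by case=> /subst_comb_neq_Var.
- by case=> /IH1 -> /IH2 ->.
Qed.

Lemma no_nontrivial_identities_from_one (T : Type) (op : T -> T -> T)
    (n : nat) :
  no_nontrivial_identities 1 op -> no_nontrivial_identities n op.
Proof.
move=> no1 [G [H [neqGH eqGH]]]; apply: no1.
exists (subst (@comb_gen n) G), (subst (@comb_gen n) H).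
split=> [/subst_comb_inj //|v].
by rewrite !eval_subst.
Qed.

Theorem lemma2 (R : realType)
    (no_one_variable : no_nontrivial_identities 1 (@f R))
    (n : nat) (n_pos : 0 < n) :
  no_nontrivial_identities n (@f R).
Proof. exact: no_nontrivial_identities_from_one. Qed.
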